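(* Let $G=(V,E)$ be a connected undirected graph with $n=|V|$, let $G_F=(V,F)$ be a chordal extension of $G$, and let $\mathcal{K}=\{C_1,\dots,C_l\}$ be the set of all maximal cliques of $G_F$. Then for every integer $k$ with $2\le k\le n$, $$P^k_F=\operatorname{proj}_F P^k .$$
   Context: All graphs are finite, simple and undirected. A graph is chordal if every cycle of length at least $4$ has a chord (an edge joining two nonconsecutive vertices of the cycle). A chordal extension of $G=(V,E)$ is a chordal graph $G_F=(V,F)$ with $E\subseteq F$. Cliques are identified with their vertex sets $C_r\subseteq V$; a clique is maximal if its vertex set is not a proper subset of another clique. The vertex set $V$ is totally ordered, and $V^2:=\{\{i,j\}\subseteq V: i<j\}$ denotes the set of edges of the complete graph on $V$, so $F\subseteq V^2$. Vectors are indexed by unordered pairs, so $x_{ij}=x_{ji}$. $P^k$ is the set of all $x\in\{0,1\}^{V^2}$ such that (1) $x_{ih}+x_{hj}-x_{ij}\le 1$ for all pairwise distinct $i,j,h\in V$; (2) $\sum_{i,j\in Q:\, i<j} x_{ij}\ge 1$ for all $Q\subseteq V$ with $|Q|=k+1$. $P^k_F$ is the set of all $x\in\{0,1\}^{F}$ such that (1') $x_{ih}+x_{hj}-x_{ij}\le 1$ for all pairwise distinct $i,j,h\in C_r$, $r=1,\dots,l$; (2') $\sum_{i,j\in Q:\, i<j} x_{ij}\ge 1$ for all $Q\subseteq C_r$ with $|Q|=k+1$, $r=1,\dots,l$. For $S\subseteq\mathbb{R}^{V^2}$, $\operatorname{proj}_F S=\{x_F\in\mathbb{R}^F:\ \exists\,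 x_T\in\mathbb{R}^{V^2\setminus F},\ (x_F,x_T)\in S\}$. *)

(* Defs.v *)
From mathcomp Require Import all_boot all_order all_algebra.
From mathcomp Require Import classical_sets reals.

Set Implicit Arguments.
Unset Strict Implicit.
Unset Printing Implicit Defensive.

Import Order.TTheory GRing.Theory Num.Theory.
Local Open Scope ring_scope.

(* A graph on V is given by its edge set, a set of two-element subsets of V. *)
Section Graphs.
Context {d : Order.disp_t} {V : finOrderType d}.
Implicit Types (E F : {set {set V}}) (C : {set V}).

Definition adj E : rel V := [rel i j | [set i; j] \in E].

Definition connected_graph E : Prop := forall i j : V, connect (adj E) i j.

(* A cycle of length m is a sequence of m distinct vertices; two of its
   vertices are consecutive when one is the cyclic successor of the other. *)
Definition has_chord E (c : seq V) : Prop :=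
  exists i j : V,
    [/\ i \in c, j \in c & adj E i j] /\ [/\ i != j, j != next c i & i != next c j].

Definition chordal E : Prop :=
  forall c : seq V, ucycle (adj E) c -> (4 <= size c)%N -> has_chord E c.

Definition clique E : pred {set V} :=
  fun C => [forall i in C, forall j in C, (i != j) ==> adj E i j].

Definition max_cliques E : {set {set V}} := [set C | maxset (clique E) C].

End Graphs.

(* The set V^2 of edges of the complete graph on V. *)
Definition all_pairs {d : Order.disp_t} (V : finOrderType d) : {set {set V}} :=
  [set [set i; j] | i in V, j in V & (i < j)%O].

Definition simple_graph {d : Order.disp_t} {V : finOrderType d}
    (E : {set {set V}}) : Prop := E \subset all_pairs V.

Definition chordal_extension {d : Order.disp_t} {V : finOrderType d}
    (E F : {set {set V}}) : Prop :=
  [/\ simple_graph F, E \subset F & chordal F].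

(* R^F, for a set F of unordered pairs. *)
Definition vec (R : realType) {d : Order.disp_t} {V : finOrderType d}
    (F : {set {set V}}) : Type := {ffun {e : {set V} | e \in F} -> R}.

Section Polytopes.
Context {R : realType} {d : Order.disp_t} {V : finOrderType d}.
Implicit Types F : {set {set V}}.

(* The coordinate of x at e; the value 0 off F is a dummy. *)
Definition pcoord F (x : vec R F) (e : {set V}) : R :=
  if insub e is Some u then x u else 0.

Definition xij F (x : vec R F) (i j : V) : R := pcoord x [set i; j].

Definition binary F (x : vec R F) : Prop := forall u, x u = 0 \/ x u = 1.

Definition Pk (k : nat) : set (vec R (all_pairs V)) :=
  fun x =>
  [/\ binary x,
      forall i j h : V, i != j -> i != h -> j != h ->
        xij x i h + xij x h j - xij x i j <= 1
    & forall Q : {set V}, #|Q| = k.+1 ->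
        1 <= \sum_(i in Q) \sum_(j in Q | (i < j)%O) xij x i j].

(* For distinct i, j in a clique of F the pair {i, j} belongs to F, so the
   dummy value of pcoord is never used here. *)
Definition PkF F (k : nat) : set (vec R F) :=
  fun x =>
  [/\ binary x,
      forall C, C \in max_cliques F -> forall i j h : V,
        i \in C -> j \in C -> h \in C -> i != j -> i != h -> j != h ->
        xij x i h + xij x h j - xij x i j <= 1
    & forall C, C \in max_cliques F -> forall Q : {set V},
        Q \subset C -> #|Q| = k.+1 ->
        1 <= \sum_(i in Q) \sum_(j in Q | (i < j)%O) xij x i j].

(* The vector (x_F, x_T) of R^{V^2}, where T = V^2 \ F. *)
Definition glue F (xF : vec R F) (xT : vec R (all_pairs V :\: F)) :
    vec R (all_pairs V) :=
  [ffun u => if val u \in F then pcoord xF (val u) else pcoord xT (val u)].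

Definition proj F (S : set (vec R (all_pairs V))) : set (vec R F) :=
  fun xF => exists xT : vec R (all_pairs V :\: F), S (glue xF xT).

End Polytopes.

Arguments Pk R {d} V k.
Arguments PkF R {d V} F k.
Arguments proj {R d V} F S.

(* Main.v *)
Require Import Defs.
From mathcomp Require Import all_boot all_order all_algebra.
From mathcomp Require Import classical_sets reals.

Set Implicit Arguments.
Unset Strict Implicit.
Unset Printing Implicit Defensive.

Import boot.fintype boot.finset Order.TTheory GRing.Theory Num.Theory.

(* A point of P^k is the same thing as the partition of V induced by a colouring
   with k colours, x_ij = 1 meaning that i and j have the same colour.  A chordal
   graph has a simplicial vertex in every nonempty induced subgraph, so the
   vertices can be coloured one at a time, each new vertex v having a clique K as
   its set of coloured neighbours: either x_uv = 1 for some u in K, and v gets the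
   colour of u, or v needs a colour not used on K, which exists because K + v
   does not contain k + 1 pairwise separated vertices. *)

(** * Successors in cyclic sequences, and shortest paths *)

Lemma next_cat (T : eqType) (p1 p2 : seq T) (x y : T) :
  uniq (p1 ++ x :: y :: p2) -> next (p1 ++ x :: y :: p2) x = y.
Proof. by move=> U; rewrite -(next_rot (size p1) U) rot_size_cat /= eqxx. Qed.

Lemma next_last (T : eqType) (p : seq T) (x y : T) :
  uniq (y :: rcons p x) -> next (y :: rcons p x) x = y.
Proof.
move=> U; rewrite -(next_rot (size p).+1 U) -cats1 -cat_cons.
by rewrite (_ : (size p).+1 = size (y :: p)) // rot_size_cat /= eqxx.
Qed.

(** A path of minimal length admits no shortcut: an edge from [i] to a later [j] could replace the
    segment [p2] between them. *)
Lemma shortest_path (T : finType) (e : rel T) (s t : T) :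
  connect e s t -> exists p : seq T,
  [/\ path e s p, last s p = t, uniq (s :: p)
    & forall p1 i p2 j p3, s :: p = p1 ++ i :: p2 ++ j :: p3 -> e i j ->
      p2 = [::]].
Proof.
case/connectP=> p0 ep0 lp0.
have ex : exists n, [exists q : n.-tuple T, path e s q && (last s q == t)].
  by exists (size p0); apply/existsP; exists (in_tuple p0); rewrite ep0 lp0 /=.
case: (ex_minnP ex) => n /existsP[q /andP[eq_ /eqP lq]] nmin.
have {}nmin p : path e s p -> last s p = t -> (n <= size p)%N.
  move=> ep lp; apply: nmin; apply/existsP; exists (in_tuple p).
  by rewrite ep lp /=.
have : size q = n by rewrite size_tuple.
(* The duplicate-free path [p] uses only vertices of the minimal walk [q], so it is no longer than
   [q]. *)
case/shortenP: eq_ lq => p ep up sub lp sq.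
have szp : (size p <= n)%N.
  by rewrite -sq; apply: uniq_leq_size => //; case/andP: up.
exists p; split=> // p1 i p2 j p3 Ep eij.
apply: size0nil; apply/eqP; rewrite -leqn0.
case: p1 Ep => [|s' p1] [? Ep]; subst s' || subst i; subst p.
  have := nmin (j :: p3).
  move: ep lp szp; rewrite cat_path last_cat /= => /andP[_ /andP[_ ->]] lp szp.
  rewrite eij => /(_ isT lp) /(leq_trans szp).
  by rewrite size_cat /= -[in X in (_ <= X)%N](add0n (size p3).+1) leq_add2r.
have := nmin (p1 ++ i :: j :: p3).
move: ep lp szp.
rewrite !(cat_path, last_cat) /= cat_path last_cat /=.
move=> /and4P[-> -> _ /andP[_ ->]] lp szp.
rewrite eij => /(_ isT lp) /(leq_trans szp).
rewrite !size_cat /= size_cat /= leq_add2l !ltnS.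
by rewrite -[in X in (_ <= X)%N](add0n (size p3).+1) leq_add2r.
Qed.

(** * Simplicial vertices and colourings of chordal graphs *)

Section Chordal.
Context {d : Order.disp_t} {V : finOrderType d}.
Implicit Types (E F : {set {set V}}) (W X Q : {set V}).

Lemma adj_sym E : symmetric (adj E).
Proof. by move=> i j; rewrite /adj /= setUC. Qed.

(* A shortest path from s to t through X closes up via y to a cycle whose only
   possible chord is the edge st. *)
Lemma chordal_common_neighbor E X (s t y : V) :
  chordal E -> s != t -> y != s -> y \notin t |: X ->
  adj E y s -> adj E y t -> {in X, forall u, ~~ adj E y u} ->
  connect [rel u w | adj E u w && (w \in t |: X)] s t -> adj E s t.
Proof.
move=> chE st ys ytX yas yat yX /shortest_path[p [ep lp up short]].
apply: contraT => nst.
have inp : {in p, forall u, u \in t |: X}.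
  elim: p s ep {lp up short st ys yas nst} => //= a p IHp s.
  by case/andP=> /andP[_ atX] ep u; rewrite inE => /predU1P[-> //|/(IHp _ ep)].
have uc : uniq (y :: s :: p).
  rewrite cons_uniq up andbT inE negb_or ys.
  by apply: contra ytX => /inp.
have cc : cycle (adj E) (y :: s :: p).
  rewrite /= yas rcons_path lp adj_sym yat andbT.
  by apply: sub_path ep => u w /andP[].
(* A path with fewer than two edges would give [s = t] or the edge [st]. *)
have sz : (4 <= size (y :: s :: p))%N.
  case: p ep lp {up short inp uc cc} => [|a [|b p]] //=.
    by move=> _ /eqP; rewrite (negPf st).
  by move=> /andP[/andP[sa _] _] ta; rewrite -ta sa in nst.
have [|i [j [[ic jc aij] [ij nij nji]]]] := chE _ _ sz; first by rewrite /ucycle cc.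
(* Hence no chord ends at [y]: its only possible neighbours on the path are its two neighbours on
   the cycle. *)
have yend (w : V) : w \in s :: p -> adj E y w -> w = s \/ w = t.
  rewrite inE => /predU1P[->|/inp]; first by left.
  by rewrite 2!inE => /orP[/eqP|/yX /negPf->]; [right|].
have ny : next (y :: s :: p) y = s by rewrite /= eqxx.
have nt : next (y :: s :: p) t = y.
  by move: uc; rewrite -lp lastI; exact: next_last.
(* An edge between two vertices of the path joins consecutive ones, since the path is shortest; so
   it is not a chord either. *)
have key (a b : V) p1 p2 p3 : s :: p = p1 ++ a :: p2 ++ b :: p3 ->
    adj E a b -> b != next (y :: s :: p) a -> False.
  move=> Ep ab; have bp : b \in t |: X.
    apply: inp; case: p1 Ep => [|? p1] [_ ->];
    by rewrite !(mem_cat, inE) eqxx !orbT.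
  have p20 : p2 = [::] by apply: short Ep _; rewrite /= ab.
  rewrite Ep p20 cat0s -cat_cons next_cat ?eqxx //.
  by move: uc; rewrite Ep p20.
move: ic jc; rewrite !(in_cons y) => /predU1P[iy|ic] /predU1P[jy|jc].
- by rewrite iy jy eqxx in ij.
- move: nij nji; rewrite iy ny in aij *.
  by case: (yend j jc aij) => ->; rewrite ?nt eqxx.
- move: nij nji; rewrite jy ny adj_sym in aij *.
  by case: (yend i ic aij) => ->; rewrite ?nt eqxx.
have [p1 [p2 Ep]] : exists p1 p2, s :: p = p1 ++ i :: p2.
  by case/splitPr: ic => p1 p2; exists p1, p2.
move: jc; rewrite Ep mem_cat inE eq_sym (negPf ij) /=.
case/orP => /splitPr jp; case: jp Ep => [p3 p4] Ep.
- by exfalso; apply: (key j i p3 p4 p2) => //; [rewrite Ep -catA|rewrite adj_sym].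
by exfalso; apply: (key i j p1 p3 p4).
Qed.

Definition simplicial_in E W (v : V) : Prop :=
  forall i j, i \in W -> j \in W -> i != j -> adj E v i -> adj E v j ->
  adj E i j.

(** Dirac's theorem on simplicial vertices. The induction runs over vertex subsets [W] of one fixed
    chordal graph, so no induced subgraph has to be shown chordal. *)
Lemma chordal_simplicial E W :
  chordal E -> W != set0 -> exists2 v, v \in W & simplicial_in E W v.
Proof.
move=> chE; have [n] := ubnP #|W|; elim: n W => // n IHn W leW W0.
have [clW|] := boolP (clique E W).
  have [v vW] := set0Pn _ W0; exists v => // i j iW jW ij _ _.
  by move/forall_inP: clW => /(_ i iW) /forall_inP /(_ j jW) /implyP; apply.
rewrite negb_forall_in => /exists_inP[a aW].
rewrite negb_forall_in => /exists_inP[b bW]; rewrite negb_imply => /andP[ab nab].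
pose inX X := [rel u w | adj E u w && (w \in X)].
(* For X maximal with P, every neighbour of X outside X is adjacent to all of
   far X, and these neighbours form a clique, so a vertex simplicial in far X is
   simplicial in W. *)
pose far X := [set y in W | (y \notin X) && [forall u in X, ~~ adj E y u]].
pose P X := [&& X \subset W, far X != set0
  & [forall u in X, forall w in X, connect (inX X) u w]].
have Pa : P [set a].
  apply/and3P; split; first by rewrite sub1set.
    apply/set0Pn; exists b; rewrite !inE bW eq_sym ab /=.
    by apply/forall_inP => u /set1P ->; rewrite adj_sym.
  by apply/forall_inP => u /set1P ->; apply/forall_inP => w /set1P ->.
have [X /maxsetP[/and3P[XW Y0 cX] Xmax]] := maxset_exists Pa.
rewrite sub1set => aX.
have {}cX u w : u \in X -> w \in X -> connect (inX X) u w.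
  by move=> uX; move/forall_inP: cX => /(_ u uX)/forall_inP; apply.
have farE y u : y \in far X -> u \in X -> ~~ adj E y u.
  by rewrite inE => /and3P[_ _ /forall_inP]; apply.
(* If [s] missed some [y] in [far X], then [s |: X] would still satisfy [P], with [y] far from it,
   against the maximality of [X]. *)
have dom s u y : s \in W -> s \notin X -> u \in X -> adj E s u ->
    y \in far X -> adj E s y.
  move=> sW sX uX su yY; apply: contraT => nsy.
  suff PsX : P (s |: X) by rewrite -(Xmax _ PsX (subsetU1 s X)) setU11 in sX.
  have mono : subrel (connect (inX X)) (connect (inX (s |: X))).
    apply: connect_sub => v w /andP[vw wX]; apply: connect1.
    by rewrite /= vw inE wX orbT.
  have us : connect (inX (s |: X)) u s.
    by apply: connect1; rewrite /= adj_sym su setU11.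
  have us' : connect (inX (s |: X)) s u.
    by apply: connect1; rewrite /= su setU1r.
  apply/and3P; split.
  - by rewrite subUset sub1set sW.
  - apply/set0Pn; exists y.
    have ys : y != s by apply: contraTneq su => <-; exact: farE.
    move: (yY); rewrite !inE => /and3P[-> yX _]; rewrite negb_or ys yX /=.
    apply/forall_inP => w /setU1P[->|wX]; first by rewrite adj_sym.
    exact: farE.
  apply/forall_inP => v /setU1P[->|vX]; apply/forall_inP => w /setU1P[->|wX] //.
  - by apply: connect_trans us' _; apply/mono/cX.
  - by apply: connect_trans us; apply/mono/cX.
  by apply/mono/cX.
have [|v vY simv] := IHn (far X) _ Y0.
  rewrite -ltnS; apply: leq_trans leW; rewrite ltnS; apply: proper_card.
  apply/properP; split; first by apply/subsetP => y; rewrite inE => /andP[].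
  by exists a => //; rewrite inE aX andbF.
have vW : v \in W by move: vY; rewrite inE => /andP[].
exists v => // i j iW jW ij vi vj.
have nX w : adj E v w -> w \notin X by apply: contraTN; exact: farE.
have [iX jX] := (nX i vi, nX j vj).
have near w : w \in W -> w \notin X -> w \notin far X ->
    exists2 u, u \in X & adj E w u.
  rewrite inE => -> -> /=; rewrite negb_forall_in => /exists_inP[u uX].
  by rewrite negbK; exists u.
(* If [i] and [j] both lie in [far X], the choice of [v] applies; if exactly one does, [dom]
   applies. If neither does, a path through [X] joins them, and their common neighbour [v] closes it
   to a cycle. *)
have [iY|/(near i iW iX)[u uX iu]] := boolP (i \in far X); last first.
  have [jY|/(near j jW jX)[w wX jw]] := boolP (j \in far X); first exact: dom iu jY.
  apply: (@chordal_common_neighbor E X i j v) => //.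
  - by apply: contraTneq iu => <-; exact: farE.
  - rewrite inE in_set1 negb_or; apply/andP; split; last first.
      by move: vY; rewrite inE => /and3P[].
    by apply: contraTneq jw => <-; exact: farE.
  - by move=> x; exact: farE.
  apply: (@connect_trans _ _ u); first by apply: connect1; rewrite /= iu setU1r.
  apply: (@connect_trans _ _ w); last first.
    by apply: connect1; rewrite /= adj_sym jw setU11.
  apply: connect_sub (cX u w uX wX) => x z /andP[xz zX]; apply: connect1.
  by rewrite /= xz setU1r.
have [jY|/(near j jW jX)[w wX jw]] := boolP (j \in far X); first exact: simv.
by rewrite adj_sym; exact: dom jw iY.
Qed.

(** Here [r] stands for the relation x_ij = 1. Transitivity on triangles of [E] suffices because the
    coloured neighbours of a simplicial vertex are pairwise adjacent. *)
Lemma chordal_coloring E (r : rel V) (k : nat) :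
  chordal E -> (0 < k)%N -> symmetric r ->
  (forall i j h, i != j -> i != h -> j != h ->
    adj E i j -> adj E i h -> adj E h j -> r i h -> r h j -> r i j) ->
  (forall Q, clique E Q -> #|Q| = k.+1 ->
    exists i j, [/\ i \in Q, j \in Q, i != j & r i j]) ->
  exists c : V -> 'I_k, forall i j, i != j -> adj E i j -> (c i == c j) = r i j.
Proof.
move=> chE k0 rsym rtrans rQ.
suff color W : exists c : V -> 'I_k,
    {in W &, forall i j, i != j -> adj E i j -> (c i == c j) = r i j}.
  by have [c cP] := color setT; exists c => i j; apply: cP; rewrite inE.
have [n] := ubnP #|W|; elim: n W => // n IHn W leW.
have [->|W0] := eqVneq W set0.
  (* Even with nothing to colour, a function into ['I_k] needs one colour to exist. *)
  by exists (fun=> Ordinal k0) => i j; rewrite inE.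
have [v vW simv] := chordal_simplicial chE W0.
have [|c cP] := IHn (W :\ v).
  by move: leW; rewrite (cardsD1 v W) vW.
suff [a aP] : exists a : 'I_k, forall u, u \in W -> u != v -> adj E v u ->
    (a == c u) = r v u.
  exists (fun u => if u == v then a else c u) => i j iW jW ij adij.
  have [iv|iv] := eqVneq i v; have [jv|jv] := eqVneq j v.
  - by rewrite iv jv eqxx in ij.
  - by rewrite iv in adij *; exact: aP.
  - by rewrite jv adj_sym in adij *; rewrite eq_sym rsym; exact: aP.
  - by apply: cP; rewrite // !inE ?iv ?jv.
have [/exists_inP[u uW /and3P[uv vu rvu]]|] :=
    boolP [exists u in W, [&& u != v, adj E v u & r v u]].
  exists (c u) => w wW wv vw; have [<-|uw] := eqVneq u w; first by rewrite eqxx rvu.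
  (* By simpliciality [v], [u], [w] form a triangle, so transitivity gives both directions: the
     colour of [u] is right with respect to every [w]. *)
  have uwE := simv _ _ uW wW uw vu vw.
  rewrite cP ?inE ?uv ?wv //; apply/idP/idP => [ruw|rvw].
    by apply: (rtrans v w u); rewrite // eq_sym.
  by apply: (rtrans u w v); rewrite // ?(adj_sym E u v) ?(rsym u v).
rewrite negb_exists_in => /forall_inP nr.
have {}nr u : u \in W -> u != v -> adj E v u -> r v u = false.
  by move=> uW uv vu; move: (nr u uW); rewrite uv vu => /negPf.
pose N := [set u in W | (u != v) && adj E v u].
have [/existsP[a /forall_inP aN]|] := boolP [exists a : 'I_k, [forall u in N, c u != a]].
  exists a => u uW uv vu; rewrite nr // eq_sym; apply/negbTE.
  by apply: aN; rewrite inE uW uv.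
rewrite negb_exists => /forallP allc.
have {}allc a : exists u, (u \in N) && (c u == a).
  move: (allc a); rewrite negb_forall_in => /exists_inP[u uN].
  by rewrite negbK => ca; exists u; rewrite uN.
(* All [k] colours occur on [N]. One neighbour per colour, together with [v], forms a clique of
   [k + 1] vertices, no two of them related by [r], against [rQ]. *)
pose g a := xchoose (allc a).
have gN a : g a \in N by case/andP: (xchooseP (allc a)).
have cg : cancel g c by move=> a; case/andP: (xchooseP (allc a)) => _ /eqP.
have gW a : [/\ g a \in W, g a != v & adj E v (g a)].
  by move: (gN a); rewrite inE => /and3P.
have vg : v \notin g @: setT.
  by apply/imsetP => -[a _ va]; have [_] := gW a; rewrite va eqxx.
have gg a b : g a != g b -> adj E (g a) (g b).
  by have [? ? ?] := gW a; have [? ? ?] := gW b => ?; exact: simv.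
have [||i [j []]] := rQ (v |: g @: setT).
- apply/forall_inP => i /setU1P[->|/imsetP[a _ ->]];
    apply/forall_inP => j /setU1P[->|/imsetP[b _ ->]]; apply/implyP.
  + by rewrite eqxx.
  + by have [] := gW b.
  + by have [] := gW a; rewrite adj_sym.
  + exact: gg.
- by rewrite cardsU1 vg card_imset ?cardsT ?card_ord //; exact: can_inj cg.
move=> /setU1P[->|/imsetP[a _ ->]] /setU1P[->|/imsetP[b _ ->]].
- by rewrite eqxx.
- by have [? ? ?] := gW b; rewrite nr.
- by have [? ? ?] := gW a; rewrite rsym nr.
move=> gab; have [? ? ?] := gW a; have [? ? ?] := gW b.
rewrite -cP ?gg ?inE //; [|exact/andP|exact/andP].
by rewrite !cg => /eqP ab; rewrite ab eqxx in gab.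
Qed.

End Chordal.

(** * Binary vectors, cliques and the two inclusions *)

Local Open Scope ring_scope.

Lemma set2_all_pairs (d : Order.disp_t) (V : finOrderType d) (i j : V) :
  i != j -> [set i; j] \in all_pairs V.
Proof.
case/lt_total/orP => ij; apply/imset2P; last rewrite setUC.
  by exists i j; rewrite ?inE.
by exists j i; rewrite ?inE.
Qed.

Lemma clique_adj (d : Order.disp_t) (V : finOrderType d) (F : {set {set V}})
    (C : {set V}) (i j : V) :
  clique F C -> i \in C -> j \in C -> i != j -> adj F i j.
Proof.
move=> /forall_inP clC iC jC; move: (clC i iC) => /forall_inP /(_ j jC).
by move/implyP.
Qed.

Lemma clique_max_cliques (d : Order.disp_t) (V : finOrderType d)
    (F : {set {set V}}) (Q : {set V}) :
  clique F Q -> exists2 C, C \in max_cliques F & Q \subset C.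
Proof. by case/maxset_exists=> C mC QC; exists C; rewrite ?inE. Qed.

Lemma xij_sym (R : realType) (d : Order.disp_t) (V : finOrderType d)
    (F : {set {set V}}) (x : vec R F) (i j : V) : xij x i j = xij x j i.
Proof. by rewrite /xij setUC. Qed.

Lemma xij_binary (R : realType) (d : Order.disp_t) (V : finOrderType d)
    (F : {set {set V}}) (x : vec R F) (i j : V) :
  binary x -> xij x i j = 0 \/ xij x i j = 1.
Proof. by rewrite /xij /pcoord => xb; case: insubP => [u _ _|_]; [|left]. Qed.

Lemma pcoord_glue (R : realType) (d : Order.disp_t) (V : finOrderType d)
    (F : {set {set V}}) (xF : vec R F) (xT : vec R (all_pairs V :\: F))
    (e : {set V}) :
  e \in all_pairs V ->
  pcoord (glue xF xT) e = if e \in F then pcoord xF e else pcoord xT e.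
Proof. by move=> eP; rewrite {1}/pcoord insubT ffunE /=. Qed.

(** A sum of zeros and ones reaches 1 only through a term equal to 1; by symmetry of [xij] the pair
    need not be ordered. *)
Lemma cover_pair (R : realType) (d : Order.disp_t) (V : finOrderType d)
    (F : {set {set V}}) (x : vec R F) (Q : {set V}) :
  binary x ->
  (1 <= \sum_(i in Q) \sum_(j in Q | (i < j)%O) xij x i j) <->
  exists i j, [/\ i \in Q, j \in Q, i != j & xij x i j = 1].
Proof.
move=> xb; have x0 i j : 0 <= xij x i j.
  by have [->|->] := xij_binary i j xb.
split=> [le1|].
  have [/exists_inP[i iQ /exists_inP[j jQ /andP[ij /eqP xE]]]|] :=
      boolP [exists i in Q, exists j in Q, (i != j) && (xij x i j == 1)].
    by exists i, j.
  rewrite negb_exists_in => /forall_inP H; move: le1.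
  rewrite big1 ?ler10 // => i iQ; rewrite big1 // => j /andP[jQ ij].
  move: (H i iQ); rewrite negb_exists_in => /forall_inP /(_ j jQ).
  rewrite (lt_eqF ij) /= => /eqP; by case: (xij_binary i j xb).
case=> i [j [iQ jQ ij xE]].
wlog lij : i j iQ jQ ij xE / (i < j)%O.
  move=> H; case/lt_total/orP: (ij) => lij; first exact: (H i j).
  by apply: (H j i); rewrite // 1?eq_sym // xij_sym.
rewrite (bigD1 i) //= (bigD1 j) ?jQ //= xE -addrA lerDl.
by rewrite addr_ge0 ?sumr_ge0 // => h _; rewrite sumr_ge0.
Qed.

(** Pairs inside a clique lie in [F], where [glue] copies [x], so the clique constraints are
    instances of those of [Pk]. *)
Lemma proj_Pk_sub (R : realType) (d : Order.disp_t) (V : finOrderType d)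
    (F : {set {set V}}) (k : nat) (x : vec R F) :
  simple_graph F -> proj F (Pk R V k) x -> PkF R F k x.
Proof.
move=> /subsetP sF [xT [yb ytri ycov]].
have xy C i j : C \in max_cliques F -> i \in C -> j \in C -> i != j ->
    xij (glue x xT) i j = xij x i j.
  rewrite inE => /maxsetP[clC _] iC jC ij; have := clique_adj clC iC jC ij.
  by rewrite /adj /= /xij => eF; rewrite pcoord_glue ?sF // eF.
have xb : binary x.
  move=> u; have := yb (exist (fun e => e \in all_pairs V) (val u) (sF _ (valP u))).
  rewrite ffunE /= (valP u) /pcoord; case: insubP => [w _ /val_inj-> //|].
  by rewrite (valP u).
split=> // [C Cm i j h iC jC hC ij ih jh|C Cm Q QC cQ].
  by rewrite -!(xy C) // 1?eq_sym //; exact: ytri.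
have /cover_pair : 1 <= \sum_(i in Q) \sum_(j in Q | (i < j)%O) xij (glue x xT) i j.
  exact: ycov.
move=> /(_ yb)[i [j [iQ jQ ij xE]]]; apply/cover_pair => //.
by exists i, j; rewrite -(xy C) // (subsetP QC).
Qed.

(** Triangles and (k+1)-cliques of [F] extend to maximal cliques, so the constraints of [PkF] give
    the hypotheses of [chordal_coloring]; the colouring then supplies the missing coordinates. *)
Lemma PkF_sub_proj (R : realType) (d : Order.disp_t) (V : finOrderType d)
    (F : {set {set V}}) (k : nat) (x : vec R F) :
  chordal F -> (0 < k)%N -> PkF R F k x -> proj F (Pk R V k) x.
Proof.
move=> chF k0 [xb xtri xcov].
have [|i j h ij ih jh aij aih ahj /eqP xih /eqP xhj|Q clQ cQ|c cP] :=
  @chordal_coloring _ V F [rel i j | xij x i j == 1] k chF k0.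
- by move=> i j; rewrite /= xij_sym.
- have clQ : clique F [set i; j; h].
    apply/forall_inP => u uQ; apply/forall_inP => w wQ.
    by move: uQ wQ; rewrite !inE -!orbA => /or3P[]/eqP-> /or3P[]/eqP->;
      rewrite ?eqxx // ?aij ?aih ?ahj 1?adj_sym ?aij ?aih ?ahj ?implybT.
  have [C Cm /subsetP QC] := clique_max_cliques clQ.
  have := xtri C Cm i j h; rewrite !QC ?inE ?eqxx ?orbT // xih xhj.
  move=> /(_ isT isT isT ij ih jh) /=.
  (* With [xij x i j = 0] the constraint would read [1 + 1 <= 1]. *)
  have [->|->] := xij_binary i j xb; last by rewrite eqxx.
  by rewrite subr0 gerDl ler10.
- have [C Cm QC] := clique_max_cliques clQ.
  have /(cover_pair _ xb)[i [j [iQ jQ ij xE]]] := xcov C Cm Q QC cQ.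
  by exists i, j; rewrite /= xE eqxx.
(* A coordinate is indexed by a set. Comparing all its elements gives 1 at [[set i; j]] exactly when
   [c i = c j], without choosing endpoints. *)
pose xT : vec R (all_pairs V :\: F) :=
  [ffun u : {e | e \in all_pairs V :\: F} => [forall i in val u, forall j in val u, c i == c j]%:R].
exists xT.
have yE i j : i != j -> xij (glue x xT) i j = (c i == c j)%:R.
  move=> ij; have eP := set2_all_pairs ij; rewrite /xij pcoord_glue //.
  case: ifPn => [eF|eF].
    rewrite (cP i j) //= -/(xij x i j).
    by have [->|->] := xij_binary i j xb; rewrite ?eqxx // eq_sym oner_eq0.
  have eT : [set i; j] \in all_pairs V :\: F by rewrite inE eF.
  rewrite /pcoord insubT ffunE /=; congr (_%:R); congr nat_of_bool.
  apply/idP/idP => [/forall_inP/(_ i (set21 i j))/forall_inP|/eqP cij].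
    by apply; rewrite set22.
  by apply/forall_inP => u /set2P[]->; apply/forall_inP => w /set2P[]->;
    rewrite ?cij.
have yb : binary (glue x xT).
  move=> [e eP]; have /imset2P[i j _] := eP; rewrite inE => /andP[_ lij] eE.
  have := yE i j; rewrite (lt_eqF lij) => /(_ isT).
  rewrite /xij -eE /pcoord insubT => ->.
  by case: eqP; [right|left].
split=> // [i j h ij ih jh|Q cQ].
  rewrite !yE // 1?eq_sym //.
  (* The inequality expresses transitivity of having equal colours; only the case where both
     equalities hold needs it. *)
  have [ih_|] := eqVneq (c i) (c h); have [hj_|] := eqVneq (c h) (c j) => //=.
  - by rewrite ih_ hj_ eqxx addrK.
  - by move=> _; rewrite addr0 gerBl ler0n.
  - by move=> _; rewrite add0r gerBl ler0n.
  - by move=> _ _; rewrite addr0 sub0r (le_trans _ ler01) ?oppr_le0 ?ler0n.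
apply/cover_pair => //.
(* Pigeonhole: [Q] has [k + 1] vertices and there are [k] colours. *)
have /dinjectivePn[i iQ [j /andP[ij jQ] cij]] : ~~ dinjectiveb c (mem Q).
  apply/negP => /dinjectiveP cinj.
  by have := max_card (mem (c @: Q)); rewrite card_in_imset // cQ card_ord ltnn.
by exists i, j; rewrite yE 1?eq_sym // cij eqxx.
Qed.

Theorem theorem1 (R : realType) (d : Order.disp_t) (V : finOrderType d)
    (E F : {set {set V}}) (k : nat) :
  simple_graph E ->
  connected_graph E ->
  chordal_extension E F ->
  (2 <= k <= #|V|)%N ->
  PkF R F k = proj F (Pk R V k).
Proof.
move=> _ _ [sF _ chF] /andP[k2 _]; apply/seteqP; split=> x.
  by apply: PkF_sub_proj => //; exact: ltnW.
exact: proj_Pk_sub.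
Qed.
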